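(* Let $p$ be a prime number and $k\ge 1$. If $\gcd(k,p^k-1)=1$, then there is an equational proof that every $p^k$-ring with $p=0$ is commutative.
   Context: Rings are associative and unital, not necessarily commutative; the zero ring is allowed. For an integer $n>1$, an $n$-ring is a ring in which $x^n=x$ holds for every element $x$. Equational proofs. An algebraic theory $\mathcal{T}$ is given by operation symbols of finite arities and a set of axioms, each an equation between terms. An equational proof of $\sigma=\tau$ in $\mathcal{T}$ (written $\mathcal{T}\vdash\sigma=\tau$) is a deduction by the rules: (1) if $\sigma=\tau$ is an axiom then $\mathcal{T}\vdash\sigma=\tau$; (2) $\mathcal{T}\vdash\sigma=\sigma$; (3) if $\mathcal{T}\vdash\sigma=\tau$ then $\mathcal{T}\vdash\tau=\sigma$; (4) if $\mathcal{T}\vdash\sigma=\tau$ and $\mathcal{T}\vdash\tau=\rho$ then $\mathcal{T}\vdash\sigma=\rho$; (5) if $\rho$ is a term of arity $r$ and $\mathcal{T}\vdash\sigma_i=\tau_i$ for $i=1,\dots,r$, then $\mathcal{T}\vdash\rho(\sigma_1,\dots,\sigma_r)=\rho(\tau_1,\dots,\tau_r)$; (6) if $\sigma,\tau$ are terms of arity $r$ with $\mathcal{T}\vdash\sigma=\tau$, then $\mathcal{T}\vdash\sigma(\rho_1,\dots,\rho_r)=\tau(\rho_1,\dots,\rho_r)$ for all terms $\rho_1,\dots,\rho_r$. The theory of $p^k$-rings with $p=0$ consists of the ring axioms (operations $+,-,0,\cdot,1$) together with the axioms $x^{p^k}=x$ and $p\cdot 1=0$. ''There is an equational proof that every such ring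 is commutative'' means that this theory proves $xy=yx$ for two distinct variables $x,y$. *)

(* Defs.v *)
(* MathComp *)
From mathcomp Require Import all_boot.

Set Implicit Arguments.
Unset Strict Implicit.
Unset Printing Implicit Defensive.

Record signature := Signature { op : Type; arity : op -> nat }.

(* A term of arity r is a term in the variables indexed by 'I_r. *)
Inductive term (S : signature) (r : nat) : Type :=
| Var of 'I_r
| App (f : op S) of ('I_(arity f) -> term S r).

Arguments Var {S r} _.
Arguments App {S r} f _.

(* substitution: [subst rho t] is t(rho_1, ..., rho_r) *)
Fixpoint subst (S : signature) (r n : nat) (rho : 'I_r -> term S n)
    (t : term S r) : term S n :=
  match t with
  | Var i => rho i
  | App f args => App f (fun j => subst rho (args j))
  end.

Record theory := Theory {
  sig :> signature;
  axioms : forall r, term sig r -> term sig r -> Prop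
}.

Inductive proves (T : theory) : forall r, term T r -> term T r -> Prop :=
| proves_axiom r (s t : term T r) : axioms s t -> proves s t
| proves_refl r (s : term T r) : proves s s
| proves_sym r (s t : term T r) : proves s t -> proves t s
| proves_trans r (s t u : term T r) : proves s t -> proves t u -> proves s u
| proves_congr r n (rho : term T r) (s t : 'I_r -> term T n) :
    (forall i, proves (s i) (t i)) -> proves (subst s rho) (subst t rho)
| proves_subst r n (s t : term T r) (rho : 'I_r -> term T n) :
    proves s t -> proves (subst rho s) (subst rho t).

Arguments proves T {r} s t.

Inductive ring_op := Add | Opp | Zero | Mul | One.

Definition ring_arity (f : ring_op) : nat :=
  match f with Add => 2 | Opp => 1 | Zero => 0 | Mul => 2 | One => 0 end.

Definition ring_sig : signature := Signature ring_arity.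

Notation rterm := (term ring_sig).

Section RingTerms.
Variable r : nat.
Implicit Types s t : rterm r.

Definition tvar (i : nat) (lt_i_r : i < r) : rterm r := Var (Ordinal lt_i_r).

Definition tadd s t : rterm r := @App ring_sig r Add (tnth [tuple s; t]).
Definition topp s : rterm r := @App ring_sig r Opp (tnth [tuple s]).
Definition tzero : rterm r := @App ring_sig r Zero (tnth [tuple]).
Definition tmul s t : rterm r := @App ring_sig r Mul (tnth [tuple s; t]).
Definition tone : rterm r := @App ring_sig r One (tnth [tuple]).

(* t ^ n = t * (t * ... * t) and n . t = t + (t + ... + t), with n copies of t;
   the same recursion as for ^+ and *+ in rings *)
Definition tpow t (n : nat) : rterm r := iterop n tmul t tone.
Definition tmuln t (n : nat) : rterm r := iterop n tadd t tzero.
End RingTerms.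

(* & : the arity is inferred from the expected type *)
Arguments tvar {r} & i lt_i_r.
Arguments tadd {r} & s t.
Arguments topp {r} & s.
Arguments tmul {r} & s t.
Arguments tpow {r} & t n.
Arguments tmuln {r} & t n.
Arguments tzero {r}.
Arguments tone {r}.

Declare Scope rterm_scope.
Delimit Scope rterm_scope with T.
Bind Scope rterm_scope with term.
Notation "s + t" := (tadd s t) : rterm_scope.
Notation "- s" := (topp s) : rterm_scope.
Notation "s * t" := (tmul s t) : rterm_scope.
Notation "0" := tzero : rterm_scope.
Notation "1" := tone : rterm_scope.

(* The i-th variable, for literals i < r (isT is then a proof of i < r). *)
Notation "''v_' i" := (tvar i isT)
  (at level 8, i at level 2, format "''v_' i").

Inductive ring_axiom : forall r, rterm r -> rterm r -> Prop :=
| ax_addA : @ring_axiom 3 ('v_0 + ('v_1 + 'v_2)) (('v_0 + 'v_1) + 'v_2)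
| ax_addC : @ring_axiom 2 ('v_0 + 'v_1) ('v_1 + 'v_0)
| ax_add0 : @ring_axiom 1 (0 + 'v_0) 'v_0
| ax_addN : @ring_axiom 1 (- 'v_0 + 'v_0) 0
| ax_mulA : @ring_axiom 3 ('v_0 * ('v_1 * 'v_2)) (('v_0 * 'v_1) * 'v_2)
| ax_mul1l : @ring_axiom 1 (1 * 'v_0) 'v_0
| ax_mul1r : @ring_axiom 1 ('v_0 * 1) 'v_0
| ax_mulDl : @ring_axiom 3 (('v_0 + 'v_1) * 'v_2) ('v_0 * 'v_2 + 'v_1 * 'v_2)
| ax_mulDr : @ring_axiom 3 ('v_0 * ('v_1 + 'v_2)) ('v_0 * 'v_1 + 'v_0 * 'v_2).

Inductive pk_ring_axiom (p k : nat) : forall r, rterm r -> rterm r -> Prop :=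
| ax_ring r (s t : rterm r) : ring_axiom s t -> pk_ring_axiom p k s t
| ax_pow : @pk_ring_axiom p k 1 (tpow 'v_0 (p ^ k)) 'v_0
| ax_char : @pk_ring_axiom p k 0 (tmuln 1 p) 0.

Definition pk_ring_theory (p k : nat) : theory :=
  @Theory ring_sig (pk_ring_axiom p k).

(* Main.v *)
(* Provable equality is equality in the quotient of the terms by provability,
   which is a ring R with x^(p^k) = x and p = 0, so it suffices that such rings
   are commutative.  R is reduced, so its idempotents are central, and hence so is
   every c with c^p = c.  For a in R put f = \prod_(i < k) (X - a^(p^i)).  Its
   coefficients are fixed by the Frobenius map, as a^(p^k) = a, so they are
   central; as f(a) = 0, f kills the right multiplication by a.  So the operators
   y |-> y a - a^(p^j) y compose to 0.  If y a = a^(p^j) y, then iterating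
   conjugation by y, with y^(p^k - 1) idempotent and k coprime to p^k - 1, gives
   y a = a y.  So each factor can be replaced by y |-> y a - a y, whose square has
   the same kernel, and y a = a y for all y. *)

From HB Require Import structures.
From mathcomp Require Import all_boot all_algebra generic_quotient finfield.
From mathcomp Require Import boolp.
(* After all_algebra, so that %T means rterm_scope and not GRing.term. *)
Require Import Defs.

Set Implicit Arguments.
Unset Strict Implicit.
Unset Printing Implicit Defensive.

Import GRing.Theory.

(** * Idempotents of reduced rings *)

Section Reduced.
Local Open Scope ring_scope.
Variable R : pzRingType.
Hypothesis redR : forall x : R, x * x = 0 -> x = 0.

(** Both e x (1 - e) and (1 - e) x e have square zero. *)
Lemma idem_central (e x : R) : e * e = e -> e * x = x * e.
Proof.
move=> ee; have eeM y : e * (e * y) = e * y by rewrite mulrA ee.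
have /subr0_eq-> : e * x - e * x * e = 0.
  by apply: redR; rewrite mulrBl !mulrBr -!mulrA !eeM subrr.
have /subr0_eq-> // : x * e - e * x * e = 0.
by apply: redR; rewrite mulrBl !mulrBr -!mulrA !eeM !subrr.
Qed.

End Reduced.

Lemma expr_eq_reduced (R : pzRingType) (n : nat) (x : R) :
  1 < n -> (x ^+ n = x -> x * x = 0 -> x = 0)%R.
Proof. by case: n => [|[|n]] // _ xn xx; rewrite -xn !exprS mulrA xx mul0r. Qed.

(** * Commutativity of p^k-rings of characteristic p *)

Section PkRing.
Local Open Scope ring_scope.
Variables (R : nzRingType) (p k : nat).
Hypotheses (charRp : p \in [pchar R]) (k_gt0 : (0 < k)%N).
Hypothesis powR : forall x : R, x ^+ (p ^ k) = x.

Let p_prime : prime p := pcharf_prime charRp.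
Let p_gt1 : (1 < p)%N := prime_gt1 p_prime.

Let pk_gt1 : (1 < p ^ k)%N.
Proof. by rewrite (leq_trans p_gt1) // -{1}(expn1 p) leq_exp2l. Qed.

Lemma pk_idem_central (e x : R) : e * e = e -> e * x = x * e.
Proof. by apply: idem_central => y; apply: expr_eq_reduced (powR y). Qed.

(** In the ['F_p]-algebra [R], evaluate at [c] the identity X^p - X = \prod_i (X - i) over
    ['F_p]. *)
Lemma Frobenius_fixed_prod (c : R) :
  c ^+ p = c -> \prod_(i : 'F_p) (c - i%:R) = 0.
Proof.
move=> cp; pose A := pPrimeCharType charRp.
have := congr1 (horner_alg (c : A)) (finField_genPoly 'F_p).
rewrite card_Fp // rmorphB rmorphXn rmorph_prod /= horner_algX [X in X - _]cp.
rewrite subrr => ->; apply: eq_bigr => i _.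
by rewrite rmorphB /= horner_algX horner_algC /GRing.scale /= /pprimeChar_scale mulr1.
Qed.

(* For [i] in the prime field, [e = (c - i)^(p-1)] is a central idempotent and
   the commutator [z] of [c] and [x] satisfies [z e = z]. *)
Lemma Frobenius_fixed_central (c x : R) : c ^+ p = c -> c * x = x * c.
Proof.
move=> cp; apply: subr0_eq; set z := _ - _.
(* The factors are cancelled one at a time from the right, until only z * 1 = 0 is left. *)
suff cancel (s : seq 'F_p) : z * \prod_(i <- s) (c - i%:R) = 0 -> z = 0.
  by apply: (cancel (index_enum 'F_p)); rewrite Frobenius_fixed_prod ?mulr0.
elim/last_ind: s => [|s i IHs]; first by rewrite big_nil mulr1.
rewrite big_rcons /=; set u := \prod_(_ <- _) _; set d := c - _ => zud0.
have dp : d ^+ p = d.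
  have cC : GRing.comm c i%:R by apply: commr_nat.
  have := pFrobenius_autB_comm charRp cC.
  by rewrite pFrobenius_aut_nat !pFrobenius_autE cp.
have de : d * d ^+ p.-1 = d by rewrite -exprS prednK // prime_gt0.
have [r pr] : exists r, p.-1 = r.+1 by case: (p) p_gt1 => [|[|r]] // _; exists r.
have ee : d ^+ p.-1 * d ^+ p.-1 = d ^+ p.-1.
  by rewrite {1}pr exprSr -mulrA de -exprSr -pr.
have eC y := pk_idem_central y ee.
have zd : z = d * x - x * d.
  by rewrite mulrBl mulrBr opprB (commr_nat x) addrA subrK.
have ze : z * d ^+ p.-1 = z.
  by rewrite zd mulrBl -!mulrA de -eC mulrA de.
apply: IHs; rewrite -ze -mulrA eC.
by rewrite pr exprS !mulrA -(mulrA z) zud0 mul0r.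
Qed.

Lemma pk_pow_iter (a : R) n : a ^+ (p ^ (k * n)) = a.
Proof. by elim: n => [|n IHn]; rewrite ?muln0 // mulnS expnD exprM powR. Qed.

Lemma conj_exp (a y : R) m n : y * a = a ^+ m * y -> y ^+ n * a = a ^+ (m ^ n) * y ^+ n.
Proof.
move=> ya; have yam i : y * a ^+ i = a ^+ (m * i) * y.
  elim: i => [|i IHi]; first by rewrite muln0 mulr1 mul1r.
  by rewrite exprSr mulrA IHi -mulrA ya mulrA -exprD mulnS addnC.
elim: n => [|n IHn]; first by rewrite mulr1 mul1r.
by rewrite exprS -mulrA IHn mulrA yam -expnS mulrA.
Qed.

Hypothesis k_coprime : coprime k (p ^ k - 1).

(* With [u * (p^k - 1) = 1 + v * k], the central idempotent
   [e = y^(u * (p^k - 1))] satisfies [e a = a^(p^j) e]. *)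
Lemma conj_Frobenius_comm (a y : R) j : y * a = a ^+ (p ^ j) * y -> y * a = a * y.
Proof.
move=> ya; have m_gt0 : (0 < p ^ k - 1)%N by rewrite subn_gt0.
have [u v uv _] := egcdnP k m_gt0.
have {}uv : (u * (p ^ k - 1) = v * k + 1)%N.
  by rewrite uv gcdnC; have /eqP -> := k_coprime.
pose e := y ^+ (u * (p ^ k - 1)).
have ey : e * y = y.
  rewrite /e; elim: (u) => [|n IHn]; first by rewrite mul1r.
  by rewrite mulSn exprD -mulrA IHn -exprSr subn1 prednK ?powR // ltnW.
(* By [uv] the exponent in [e] is positive, so one [e] has a factor [y], which absorbs the other. *)
have ee : e * e = e.
  by rewrite {2 3}/e uv addn1 exprS mulrA ey.
(* Each [y] moved past [a] contributes a power p^j, so the exponent is p^(j (v k + 1)); the part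
   p^(j v k) drops out as a^(p^k) = a. *)
have ea : e * a = a ^+ (p ^ j) * e.
  rewrite (conj_exp _ ya) -/e -expnM uv mulnDr muln1 mulnA (mulnC _ k).
  by rewrite expnD exprM pk_pow_iter.
by rewrite ya -{1}ey mulrA -ea -{2}ey (pk_idem_central _ ee) mulrA.
Qed.

(* If z = y a - a y commutes with a, then [y, a^n] = n a^(n-1) z, which vanishes
   for n = p^k, where a^n = a. *)
Lemma comm_commutator (a y : R) :
  (y * a - a * y) * a = a * (y * a - a * y) -> y * a = a * y.
Proof.
set z := y * a - a * y => za.
have yX n : y * a ^+ n = a ^+ n * y + a ^+ n.-1 * z *+ n.
  elim: n => [|n IHn]; first by rewrite mulr1 mul1r mulr0n addr0.
  rewrite exprSr mulrA IHn mulrDl mulrnAl -!mulrA za.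
  have -> : y * a = a * y + z by rewrite addrC subrK.
  rewrite mulrDr -addrA !mulrA -exprSr; congr (_ + _).
  by case: n {IHn} => [|n]; rewrite ?addr0 // -exprSr -mulrS.
have := yX (p ^ k)%N; rewrite powR => ->.
have -> : (p ^ k = p * p ^ k.-1)%N by rewrite -expnS prednK.
by rewrite mulrnA (mulrn_pchar charRp) mul0rn addr0.
Qed.

(** * The polynomial whose roots are the Frobenius conjugates of [a] *)

Section ConjugatePoly.
Variable a : R.

(** The offset [m] allows the comparison of f ([m = 0]) with its Frobenius twist ([m = 1]). *)
Definition conj_poly m n : {poly R} := \prod_(i < n) ('X - (a ^+ (p ^ (m + i)))%:P).

Lemma comm_conj_poly z m n : GRing.comm z a -> GRing.comm z%:P (conj_poly m n).
Proof.
move=> za; apply: commr_prod => i _; apply: commrB; first exact: commr_polyX.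
by rewrite /GRing.comm -!polyCM (commrX _ za).
Qed.

Lemma comm_coef_conj_poly z m n i :
  GRing.comm z a -> GRing.comm z (conj_poly m n)`_i.
Proof.
by move=> za; have /(congr1 (coefp i)) := comm_conj_poly m n za; rewrite /= coefCM coefMC.
Qed.

(** The Frobenius map respects sums and products of commuting elements, and the coefficients commute
    with [a] and with each other. *)
Lemma coef_conj_polyS n i : (conj_poly 1 n)`_i = (conj_poly 0 n)`_i ^+ p.
Proof.
have coefS m l j : (conj_poly m l.+1)`_j =
    (if j is j'.+1 then (conj_poly m l)`_j' else 0)
    - (conj_poly m l)`_j * a ^+ (p ^ (m + l)).
  by rewrite /conj_poly big_ord_recr /= mulrBr coefB coefMX coefMC; case: j.
elim: n i => [|n IHn] i.
  rewrite /conj_poly !big_ord0 coef1; case: eqP; rewrite ?expr1n //.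
  by rewrite expr0n gtn_eqF // prime_gt0.
have comm_a j : GRing.comm (conj_poly 0 n)`_j a.
  by apply: commr_sym; apply: comm_coef_conj_poly.
rewrite !coefS -pFrobenius_autE pFrobenius_autB_comm !(pFrobenius_autE, add0n, IHn).
  rewrite exprMn_comm; last exact: commrX.
  rewrite -exprM add1n expnSr; congr (_ - _).
  by case: i => [|i]; rewrite ?IHn // expr0n gtn_eqF // prime_gt0.
apply: commrM; last by apply: commrX; case: i => // *; apply/commr_sym/commr0.
by case: i => [|i]; [apply/commr_sym/commr0 | apply/comm_coef_conj_poly].
Qed.

(* The extreme factors agree since a^(p^k) = a; with coef_conj_polyS this makes
   the coefficients fixed by the Frobenius map. *)
Lemma conj_poly_shift : conj_poly 1 k = conj_poly 0 k.
Proof.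
rewrite /conj_poly; case: (k) k_gt0 powR => [|l] // _ powl.
rewrite big_ord_recr [RHS]big_ord_recl /= add1n powl expr1.
have := comm_conj_poly 1 l (commr_refl a).
rewrite /GRing.comm mulrBr mulrBl /conj_poly commr_polyX => ->.
by congr (_ - _ * _).
Qed.

Lemma conj_poly_central y : y%:P * conj_poly 0 k = conj_poly 0 k * y%:P.
Proof.
apply/polyP => i; rewrite coefCM coefMC -Frobenius_fixed_central //.
by rewrite -coef_conj_polyS conj_poly_shift.
Qed.

(** The first factor is X - a; the others have coefficients commuting with [a], so evaluation at [a]
    is multiplicative here. *)
Lemma horner_conj_poly : (conj_poly 0 k).[a] = 0.
Proof.
rewrite /conj_poly; case: (k) k_gt0 => [|l] // _.
rewrite big_ord_recl hornerM_comm ?hornerXsubC ?expr1 ?subrr ?mul0r //=.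
by apply/comm_coef_poly => i; rewrite -comm_coef_conj_poly.
Qed.

(* (f * y%:P).[a] is the sum of the f_i y a^i, that is f evaluated at the right
   multiplication by a and applied to y. *)
Lemma comm_of_conj_poly n y : (conj_poly 0 n * y%:P).[a] = 0 -> y * a = a * y.
Proof.
elim: n y => [|n IHn] y.
  by rewrite /conj_poly big_ord0 mul1r hornerC => ->; rewrite mul0r mulr0.
pose s := a ^+ (p ^ n); rewrite /conj_poly big_ord_recr /= -/(conj_poly 0 n) -/s.
(* Since (X - s) y = y X - s y, the last factor amounts to replacing [y] by y a - s y. *)
rewrite -mulrA mulrBl -commr_polyX -polyCM mulrBr mulrA hornerD hornerN hornerMX => yn0.
have as_ : a * s = s * a by rewrite -exprS exprSr.
have {}yn0 : (y * a - s * y) * a = a * (y * a - s * y).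
  apply: IHn; rewrite polyCB mulrBr hornerD hornerN; rewrite -[RHS]yn0; congr (_ - _).
  by rewrite polyCM mulrA hornerM_comm /comm_poly hornerC.
(* As [a] and [s] commute, so do the operators y |-> y a - s y and y |-> y a - a y; hence [yn0] says
   that z = y a - a y satisfies z a = s z. *)
apply/comm_commutator/(conj_Frobenius_comm (j := n)); rewrite -/s.
apply/subr0_eq; move/eqP: yn0; rewrite -subr_eq0 => /eqP <-.
rewrite !(mulrBl, mulrBr) !mulrA as_ !opprB.
by rewrite -!addrA; congr (_ + _); rewrite addrCA addrA addrC.
Qed.

End ConjugatePoly.

Lemma pk_ring_comm : commutative (@GRing.mul R).
Proof.
move=> a b; apply/esym/(@comm_of_conj_poly a k).
by rewrite -conj_poly_central hornerCM horner_conj_poly mulr0.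
Qed.

End PkRing.

(** The quotient of the terms is not known to be nonzero, so the zero ring is treated apart. *)
Lemma pz_pk_ring_comm (R : pzRingType) (p k : nat) :
    prime p -> 0 < k -> coprime k (p ^ k - 1) ->
    p%:R%R = 0%R :> R -> (forall x : R, x ^+ (p ^ k) = x)%R ->
  commutative (@GRing.mul R).
Proof.
move=> p_pr k_gt0 cop charR powR.
have [R0|nzR] := eqVneq (1 : R)%R 0%R.
  by move=> x y; rewrite -[LHS]mul1r -[RHS]mul1r R0 !mul0r.
pose S : nzRingType := HB.pack_for nzRingType R
  (GRing.PzSemiRing_isNonZero.Build R nzR).
have charS : (p \in [pchar S])%R by rewrite inE p_pr; apply/eqP.
exact: (@pk_ring_comm S p k charS k_gt0 powR cop).
Qed.

(** * The ring of terms modulo provable equality *)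

Lemma proves_App (T : theory) r (f : op T) (s t : 'I_(arity f) -> term T r) :
  (forall i, proves T (s i) (t i)) -> proves T (App f s) (App f t).
Proof. exact: (@proves_congr T _ _ (App f Var)). Qed.

Section FreeRing.
Variables p k r : nat.
Local Notation T := (pk_ring_theory p k).
Implicit Types s t u : rterm r.

(** The arguments of [App] form a function, so function extensionality is needed. *)
Lemma subst_tadd n (rho : 'I_n -> rterm r) (s t : rterm n) :
  subst rho (s + t)%T = (subst rho s + subst rho t)%T.
Proof. by congr App; apply/funext => -[[|[|i]]]. Qed.

Lemma subst_tmul n (rho : 'I_n -> rterm r) (s t : rterm n) :
  subst rho (s * t)%T = (subst rho s * subst rho t)%T.
Proof. by congr App; apply/funext => -[[|[|i]]]. Qed.

Lemma subst_topp n (rho : 'I_n -> rterm r) (s : rterm n) :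
  subst rho (- s)%T = (- subst rho s)%T.
Proof. by congr App; apply/funext => -[[|i]]. Qed.

Lemma subst_tzero n (rho : 'I_n -> rterm r) : subst rho 0%T = 0%T.
Proof. by congr App; apply/funext => -[]. Qed.

Lemma subst_tone n (rho : 'I_n -> rterm r) : subst rho 1%T = 1%T.
Proof. by congr App; apply/funext => -[]. Qed.

Definition subst_ring :=
  (subst_tadd, subst_tmul, subst_topp, subst_tzero, subst_tone).

Lemma subst_tpow n (rho : 'I_n -> rterm r) (s : rterm n) m :
  subst rho (tpow s m) = tpow (subst rho s) m.
Proof.
(* The induction starts at exponent 1, where [iterop] gives [s] and not s * 1. *)
case: m => [|m]; first exact: subst_tone.
by elim: m => [|m IHm] //; rewrite -[tpow s _]/(tmul s (tpow s m.+1)) subst_tmul IHm.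
Qed.

Lemma subst_tmuln n (rho : 'I_n -> rterm r) (s : rterm n) m :
  subst rho (tmuln s m) = tmuln (subst rho s) m.
Proof.
case: m => [|m]; first exact: subst_tzero.
by elim: m => [|m IHm] //; rewrite -[tmuln s _]/(tadd s (tmuln s m.+1)) subst_tadd IHm.
Qed.

Lemma proves_tadd s s' t t' : @proves T r s s' -> @proves T r t t' ->
  @proves T r (s + t)%T (s' + t')%T.
Proof. by move=> ? ?; apply: (@proves_App T r Add) => -[[|[|i]]]. Qed.

Lemma proves_tmul s s' t t' : @proves T r s s' -> @proves T r t t' ->
  @proves T r (s * t)%T (s' * t')%T.
Proof. by move=> ? ?; apply: (@proves_App T r Mul) => -[[|[|i]]]. Qed.

Lemma proves_topp s s' : @proves T r s s' -> @proves T r (- s)%T (- s')%T.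
Proof. by move=> ?; apply: (@proves_App T r Opp) => -[[|i]]. Qed.

Lemma proves_ring_axiom n (s t : rterm n) (rho : n.-tuple (rterm r)) :
  ring_axiom s t -> @proves T r (subst (tnth rho) s) (subst (tnth rho) t).
Proof. by move=> st; apply/(@proves_subst T)/(@proves_axiom T)/ax_ring. Qed.

(** Generic quotients ask for a boolean relation on a choice type; both come from classical
    logic. *)
Definition eqprov (s t : {classic (rterm r)}) : bool := `[< @proves T r s t >].

Lemma eqprov_equiv : equiv_class_of eqprov.
Proof.
split=> [s|s t|t s u].
- by apply/asboolP; apply: (@proves_refl T).
- by apply/asboolP/asboolP; apply: (@proves_sym T).
- by move=> /asboolP st /asboolP tu; apply/asboolP; apply: (@proves_trans T) st tu.
Qed.

Canonical eqprov_rel := EquivRelPack eqprov_equiv.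

(** The free p^k-ring with p = 0 on [r] generators. *)
Definition free_ring : Type := {eq_quot eqprov_rel}%qT.
HB.instance Definition _ := Choice.copy free_ring {eq_quot eqprov_rel}%qT.

Definition class (s : rterm r) : free_ring := (\pi_{eq_quot eqprov_rel} s)%qT.

Lemma classP s t : class s = class t <-> @proves T r s t.
Proof. by split=> [/eqmodP/asboolP|st] //; apply/eqmodP/asboolP. Qed.

Definition rep (x : free_ring) : rterm r := repr (x : {eq_quot eqprov_rel}%qT).

Lemma repK : cancel rep class.
Proof. exact: reprK. Qed.

Lemma rep_class s : @proves T r (rep (class s)) s.
Proof. by apply/classP; rewrite repK. Qed.

Definition fadd x y := class (rep x + rep y)%T.
Definition fmul x y := class (rep x * rep y)%T.
Definition fopp x := class (- rep x)%T.

Lemma class_add s t : class (s + t)%T = fadd (class s) (class t).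
Proof. by apply/esym/classP/proves_tadd; apply: rep_class. Qed.

Lemma class_mul s t : class (s * t)%T = fmul (class s) (class t).
Proof. by apply/esym/classP/proves_tmul; apply: rep_class. Qed.

Lemma class_opp s : class (- s)%T = fopp (class s).
Proof. by apply/esym/classP/proves_topp; apply: rep_class. Qed.

Definition class_ring := (class_add, class_mul, class_opp).

Lemma class_ring_axiom n (s t : rterm n) (rho : n.-tuple (rterm r)) :
  ring_axiom s t -> class (subst (tnth rho) s) = class (subst (tnth rho) t).
Proof. by move=> st; apply/classP/proves_ring_axiom. Qed.

Lemma faddA : associative fadd.
Proof.
move=> x y z; have := class_ring_axiom [tuple rep x; rep y; rep z] ax_addA.
by rewrite !subst_ring !class_ring !repK.
Qed.

Lemma faddC : commutative fadd.
Proof.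
move=> x y; have := class_ring_axiom [tuple rep x; rep y] ax_addC.
by rewrite !subst_ring !class_ring !repK.
Qed.

Lemma fadd0 : left_id (class 0%T) fadd.
Proof.
move=> x; have := class_ring_axiom [tuple rep x] ax_add0.
by rewrite !subst_ring !class_ring !repK.
Qed.

Lemma faddN : left_inverse (class 0%T) fopp fadd.
Proof.
move=> x; have := class_ring_axiom [tuple rep x] ax_addN.
by rewrite !subst_ring !class_ring !repK.
Qed.

Lemma fmulA : associative fmul.
Proof.
move=> x y z; have := class_ring_axiom [tuple rep x; rep y; rep z] ax_mulA.
by rewrite !subst_ring !class_ring !repK.
Qed.

Lemma fmul1l : left_id (class 1%T) fmul.
Proof.
move=> x; have := class_ring_axiom [tuple rep x] ax_mul1l.
by rewrite !subst_ring !class_ring !repK.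
Qed.

Lemma fmul1r : right_id (class 1%T) fmul.
Proof.
move=> x; have := class_ring_axiom [tuple rep x] ax_mul1r.
by rewrite !subst_ring !class_ring !repK.
Qed.

Lemma fmulDl : left_distributive fmul fadd.
Proof.
move=> x y z; have := class_ring_axiom [tuple rep x; rep y; rep z] ax_mulDl.
by rewrite !subst_ring !class_ring !repK.
Qed.

Lemma fmulDr : right_distributive fmul fadd.
Proof.
move=> x y z; have := class_ring_axiom [tuple rep x; rep y; rep z] ax_mulDr.
by rewrite !subst_ring !class_ring !repK.
Qed.

HB.instance Definition _ := GRing.isZmodule.Build free_ring faddA faddC fadd0 faddN.
HB.instance Definition _ :=
  GRing.Zmodule_isPzRing.Build free_ring fmulA fmul1l fmul1r fmulDl fmulDr.

Local Open Scope ring_scope.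

Lemma class_tpow s n : class (tpow s n) = class s ^+ n.
Proof.
case: n => // n; elim: n => // n IHn.
by rewrite -[tpow s _]/(tmul s (tpow s n.+1)) class_mul IHn [RHS]exprS.
Qed.

Lemma class_tmuln s n : class (tmuln s n) = class s *+ n.
Proof.
case: n => // n; elim: n => // n IHn.
by rewrite -[tmuln s _]/(tadd s (tmuln s n.+1)) class_add IHn [RHS]mulrS.
Qed.

Lemma free_ring_exp (x : free_ring) : x ^+ (p ^ k) = x.
Proof.
rewrite -[in LHS](repK x) -class_tpow -[RHS]repK; apply/classP.
have /(@proves_subst T _ _ _ _ (fun=> rep x)) := @proves_axiom T _ _ _ (ax_pow p k).
by rewrite subst_tpow.
Qed.

Lemma free_ring_char : p%:R = 0 :> free_ring.
Proof.
rewrite -[LHS]class_tmuln; apply/classP.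
have /(@proves_subst T _ _ _ _ (tnth ([tuple] : 0.-tuple (rterm r)))) :=
  @proves_axiom T _ _ _ (ax_char p k).
by rewrite subst_tmuln !subst_ring.
Qed.

End FreeRing.

Theorem theorem1p7 (p k : nat) (hp : prime p) (hk : 1 <= k)
    (hgcd : gcdn k (p ^ k - 1) = 1) :
  proves (pk_ring_theory p k) (r := 2) ('v_0 * 'v_1)%T ('v_1 * 'v_0)%T.
Proof.
apply/classP; rewrite !class_mul.
have cop : coprime k (p ^ k - 1) by rewrite /coprime hgcd.
exact: (pz_pk_ring_comm hp hk cop (free_ring_char p k 2) (@free_ring_exp p k 2)).
Qed.
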